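(* Let $n\ge 1$ and let $M_n$ be the monoid given by the monoid presentation with generators $f_i$ ($1\le i\le n$) and $a_{i,j}$ ($1\le i<j\le n$), and defining relations (all indices in $\{1,\dots,n\}$, and each $a_{i,j}$ occurring has $i<j$): \begin{align*} f_i^2&=f_i, &&\\ f_if_j&=f_jf_i && (i\ne j),\\ f_ka_{i,j}&=a_{i,j}f_k && (i<j,\ k\notin\{i,j\}),\\ f_ia_{i,j}&=a_{i,j}f_j=a_{i,j} && (i<j),\\ f_ja_{i,j}&=a_{i,j}f_i=f_if_j && (i<j),\\ a_{i,j}a_{k,l}&=a_{k,l}a_{i,j} && (i<j,\ k<l,\ \{i,j\}\cap\{k,l\}=\varnothing),\\ a_{j,k}a_{i,j}&=f_ja_{i,k} && (i<j<k). \end{align*} Then $M_n$ is isomorphic to $ID_n$.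
   Context: $[n]=\{1,\dots,n\}$ with its natural linear order. Partial maps act on the right and are composed from left to right: $x(\alpha\beta)=(x\alpha)\beta$ whenever defined. A partial map $\alpha$ of $[n]$ is order-decreasing if $x\alpha\le x$ for all $x\in\mathrm{dom}(\alpha)$. $ID_n$ is the monoid (under composition) of all partial one-to-one order-decreasing maps of $[n]$ (including the empty map). For a set $A$ and $R\subseteq A^*\times A^*$, the monoid presentation $\langle A:R\rangle$ denotes the quotient of the free monoid $A^*$ by the congruence generated by $R$. *)

(* Defs.v *)
From HB Require Import structures.
From mathcomp Require Import all_boot.
From mathcomp Require Import boolp.

Set Implicit Arguments.
Unset Strict Implicit.
Unset Printing Implicit Defensive.

Local Open Scope quotient_scope.

Definition monoid_isomorphic (M N : monoidType) : Prop :=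
  exists2 phi : M -> N, monoid_morphism phi & bijective phi.

Section Presentation.
Context {A : choiceType}.
Implicit Types (R : seq A -> seq A -> Prop) (u v w : seq A).

(* The free monoid on A is seq A, with concatenation and [::]. *)
Inductive congruence_of R : seq A -> seq A -> Prop :=
| cong_base u v : R u v -> congruence_of R u v
| cong_refl u : congruence_of R u u
| cong_sym u v : congruence_of R u v -> congruence_of R v u
| cong_trans u v w :
    congruence_of R u v -> congruence_of R v w -> congruence_of R u w
| cong_cat u u' v v' :
    congruence_of R u u' -> congruence_of R v v' ->
    congruence_of R (u ++ v) (u' ++ v').

(* {eq_quot _} expects a boolean relation, hence the classical `[< _ >]. *)
Definition congruence_rel R : rel (seq A) :=
  fun u v => `[< congruence_of R u v >].

Lemma congruence_rel_refl R : reflexive (congruence_rel R).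
Proof. by move=> u; apply/asboolP; exact: cong_refl. Qed.

Lemma congruence_rel_sym R : symmetric (congruence_rel R).
Proof. by move=> u v; apply/asboolP/asboolP; exact: cong_sym. Qed.

Lemma congruence_rel_trans R : transitive (congruence_rel R).
Proof.
move=> v u w /asboolP uv /asboolP vw; apply/asboolP; exact: cong_trans uv vw.
Qed.

Canonical congruence_equiv R : equiv_rel (seq A) :=
  EquivRel (congruence_rel R) (congruence_rel_refl R)
    (congruence_rel_sym R) (@congruence_rel_trans R).

Definition presented_monoid R : Type := {eq_quot congruence_equiv R}.

HB.instance Definition _ R := Choice.on (presented_monoid R).
HB.instance Definition _ R := EqQuotient.on (presented_monoid R).

Lemma presented_piP R u v :
  \pi_(presented_monoid R) u = \pi_(presented_monoid R) v <-> congruence_of R u v.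
Proof. by split=> [/eqmodP/asboolP|uv]; [|apply/eqmodP/asboolP]. Qed.

Definition presented_one R : presented_monoid R :=
  \pi_(presented_monoid R) [::].

Definition presented_mul R (x y : presented_monoid R) : presented_monoid R :=
  \pi_(presented_monoid R) (repr x ++ repr y).

Lemma presented_mul_pi R u v :
  presented_mul (\pi_(presented_monoid R) u) (\pi_(presented_monoid R) v)
  = \pi_(presented_monoid R) (u ++ v).
Proof.
by apply/presented_piP; apply: cong_cat; apply/presented_piP; rewrite reprK.
Qed.

Lemma presented_mulA R : associative (@presented_mul R).
Proof.
elim/quotW=> u; elim/quotW=> v; elim/quotW=> w.
by rewrite (presented_mul_pi R v w) (presented_mul_pi R u v) !presented_mul_pi catA.
Qed.

Lemma presented_mul1g R : left_id (presented_one R) (@presented_mul R).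
Proof. by elim/quotW=> u; rewrite presented_mul_pi. Qed.

Lemma presented_mulg1 R : right_id (presented_one R) (@presented_mul R).
Proof. by elim/quotW=> u; rewrite presented_mul_pi cats0. Qed.

HB.instance Definition _ R := isMonoid.Build (presented_monoid R)
  (@presented_mulA R) (@presented_mul1g R) (@presented_mulg1 R).

Lemma presented_piM R u v :
  \pi_(presented_monoid R) (u ++ v)
  = (\pi_(presented_monoid R) u * \pi_(presented_monoid R) v)%g.
Proof. exact: esym (presented_mul_pi R u v). Qed.

End Presentation.

(* [n] is encoded as 'I_n = {0, ..., n-1}, with the order of nat.
   A partial map sends the points outside its domain to None. *)
Definition partial_map (n : nat) : Type := {ffun 'I_n -> option 'I_n}.

Section PartialMaps.
Context {n : nat}.
Implicit Types a b c : partial_map n.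

HB.instance Definition _ := Finite.on (partial_map n).

Definition pmap_one : partial_map n := [ffun x => Some x].

(* Maps act on the right: a * b applies a first. *)
Definition pmap_mul a b : partial_map n := [ffun x => obind b (a x)].

Lemma pmap_mulA : associative pmap_mul.
Proof.
move=> a b c; apply/ffunP=> x; rewrite !ffunE.
by case: (a x) => //= y; rewrite ffunE.
Qed.

Lemma pmap_mul1g : left_id pmap_one pmap_mul.
Proof. by move=> a; apply/ffunP=> x; rewrite !ffunE. Qed.

Lemma pmap_mulg1 : right_id pmap_one pmap_mul.
Proof.
by move=> a; apply/ffunP=> x; rewrite !ffunE; case: (a x) => //= y; rewrite ffunE.
Qed.

HB.instance Definition _ := isMonoid.Build (partial_map n)
  pmap_mulA pmap_mul1g pmap_mulg1.

Definition one_to_one a : bool :=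
  [forall x, forall y, (a x != None) && (a x == a y) ==> (x == y)].

Definition order_decreasing a : bool :=
  [forall x, if a x is Some y then y <= x else true].

Definition ID_pred : {pred partial_map n} :=
  [pred a | one_to_one a && order_decreasing a].

Lemma ID_predP a :
  reflect ((forall x y z, a x = Some z -> a y = Some z -> x = y) /\
           (forall x y, a x = Some y -> y <= x))
          (a \in ID_pred).
Proof.
apply: (iffP andP) => -[inja deca]; split.
- move=> x y z ax ay; apply/eqP.
  by move/forallP/(_ x)/forallP/(_ y): inja; rewrite ax ay eqxx.
- by move=> x y ax; move/forallP/(_ x): deca; rewrite ax.
- apply/forallP=> x; apply/forallP=> y; apply/implyP=> /andP[ax /eqP axy].
  case E: (a x) ax => [z|] // _; apply/eqP.
  by apply: (inja x y z) => //; rewrite -axy.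
- by apply/forallP=> x; case E: (a x) => [y|] //; exact: deca.
Qed.

Lemma ID_pred_closed : umagma_closed ID_pred.
Proof.
split.
  by apply/ID_predP; split=> [x y z|x y]; rewrite !ffunE => -[->] // -[->].
move=> a b /ID_predP[inja deca] /ID_predP[injb decb].
apply/ID_predP; split=> [x y z|x y]; rewrite !ffunE.
  case Ex: (a x) => [x'|] //=; case Ey: (a y) => [y'|] //= bx by_.
  by apply: inja Ex _; rewrite Ey (injb _ _ _ bx by_).
case Ex: (a x) => [x'|] //= bx.
exact: leq_trans (decb _ _ bx) (deca _ _ Ex).
Qed.

End PartialMaps.

(* The product of ID n is inherited from partial_map n. *)
Record ID (n : nat) := MkID { ID_map :> partial_map n; _ : ID_map \in ID_pred }.

HB.instance Definition _ (n : nat) := [isSub for @ID_map n].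
HB.instance Definition _ (n : nat) := [Finite of ID n by <:].
HB.instance Definition _ (n : nat) :=
  SubChoice_isSubMonoid.Build (partial_map n) (@ID_pred n) (ID n) ID_pred_closed.

Lemma ID_mulE (n : nat) (a b : ID n) x :
  ID_map (a * b)%g x = obind (fun y => ID_map b y) (ID_map a x).
Proof.
by rewrite [ID_map _](valM a b) ffunE.
Qed.

Lemma ID_oneE (n : nat) x : ID_map (1%g : ID n) x = Some x.
Proof.
by rewrite [ID_map _](@val1 _ _ (ID n)) ffunE.
Qed.

(* inl i is f_i and inr (i, j) is a_{i,j}. *)
Definition ID_generator (n : nat) : Type :=
  ('I_n + {p : 'I_n * 'I_n | p.1 < p.2})%type.

HB.instance Definition _ (n : nat) := Finite.on (ID_generator n).

Definition gen_f {n : nat} (i : 'I_n) : ID_generator n := inl i.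

Definition gen_a {n : nat} (i j : 'I_n) (ij : i < j) : ID_generator n :=
  inr (exist (fun p : 'I_n * 'I_n => p.1 < p.2) (i, j) ij).

(* A chain s = t = u is split into the two relations s = t and t = u. *)
Inductive ID_relation (n : nat) :
  seq (ID_generator n) -> seq (ID_generator n) -> Prop :=
| rel_ff (i : 'I_n) :
    ID_relation [:: gen_f i; gen_f i] [:: gen_f i]
| rel_ffC (i j : 'I_n) : i != j ->
    ID_relation [:: gen_f i; gen_f j] [:: gen_f j; gen_f i]
| rel_faC (i j k : 'I_n) (ij : i < j) : k != i -> k != j ->
    ID_relation [:: gen_f k; gen_a ij] [:: gen_a ij; gen_f k]
| rel_fa_af (i j : 'I_n) (ij : i < j) :
    ID_relation [:: gen_f i; gen_a ij] [:: gen_a ij; gen_f j]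
| rel_af_a (i j : 'I_n) (ij : i < j) :
    ID_relation [:: gen_a ij; gen_f j] [:: gen_a ij]
| rel_fa_af' (i j : 'I_n) (ij : i < j) :
    ID_relation [:: gen_f j; gen_a ij] [:: gen_a ij; gen_f i]
| rel_af_ff (i j : 'I_n) (ij : i < j) :
    ID_relation [:: gen_a ij; gen_f i] [:: gen_f i; gen_f j]
| rel_aaC (i j k l : 'I_n) (ij : i < j) (kl : k < l) :
    i != k -> i != l -> j != k -> j != l ->
    ID_relation [:: gen_a ij; gen_a kl] [:: gen_a kl; gen_a ij]
| rel_aa (i j k : 'I_n) (ij : i < j) (jk : j < k) (ik : i < k) :
    ID_relation [:: gen_a jk; gen_a ij] [:: gen_f j; gen_a ik].

Definition M (n : nat) : monoidType := presented_monoid (@ID_relation n).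

(* Main.v *)
Require Import Defs.
From mathcomp Require Import all_boot.

Set Implicit Arguments.
Unset Strict Implicit.
Unset Printing Implicit Defensive.

Local Open Scope group_scope.

(** Every alpha in ID_n is the product over x = 1, ..., n, in this order, of the
    letters w_x, where w_x is f_x if x is not in the domain of alpha, w_x is 1 if
    x alpha = x, and w_x is a_{y,x} if x alpha = y < x. It therefore suffices to
    rewrite the product of a generator by such a normal form, on the left, into a
    normal form. The generator travels rightwards until it meets the letters of
    its own indices; a spurious f_y that appears there is absorbed by the letters
    to its left, because y is not in the image of the map that they define. *)

Section NormalForm.
Context {n : nat}.
Implicit Types (i j k l x y z : 'I_n) (o : option 'I_n).
Implicit Types (a b : partial_map n) (g h : M n) (u v : seq (ID_generator n)).

(** * The defining relations as identities in [M n] *)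

Definition class u : M n := \pi_(presented_monoid (@ID_relation n))%qT u.

Lemma class_cat u v : class (u ++ v) = class u * class v.
Proof. exact: presented_piM. Qed.

Lemma class_eq u v : ID_relation u v -> class u = class v.
Proof. by move=> uv; apply/presented_piP; exact: cong_base. Qed.

Definition F i : M n := class [:: gen_f i].

(* The junk value 1 outside i < j makes A i i the neutral letter. *)
Definition A i j : M n :=
  if insub (i, j) is Some p then class [:: inr p] else 1.

Lemma A_gen i j (ij : i < j) : A i j = class [:: gen_a ij].
Proof.
rewrite /A; case: insubP => [p _ pE|/negP[]] //.
by rewrite /gen_a; congr (class [:: inr _]); apply: val_inj.
Qed.

Lemma A_junk i j : j <= i -> A i j = 1.
Proof. by move=> ji; rewrite /A insubF //= ltnNge ji. Qed.

Lemma F_idem i : F i * F i = F i.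
Proof. by rewrite /F -class_cat; apply: class_eq; exact: rel_ff. Qed.

Lemma F_comm i j : F i * F j = F j * F i.
Proof.
have [->//|ij] := eqVneq i j.
by rewrite /F -!class_cat; apply: class_eq; exact: rel_ffC.
Qed.

Lemma F_A_comm i j k : k != i -> k != j -> F k * A i j = A i j * F k.
Proof.
move=> ki kj; have [ij|ji] := ltnP i j; last by rewrite A_junk // mulg1 mul1g.
by rewrite (A_gen ij) /F -!class_cat; apply: class_eq; exact: rel_faC.
Qed.

Lemma A_F_top i j : i < j -> A i j * F j = A i j.
Proof.
move=> ij; rewrite (A_gen ij) /F -!class_cat; apply: class_eq.
exact: rel_af_a.
Qed.

Lemma F_A_bot i j : i < j -> F i * A i j = A i j.
Proof.
move=> ij; rewrite -[RHS]A_F_top // (A_gen ij) /F -!class_cat.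
by apply: class_eq; exact: rel_fa_af.
Qed.

Lemma A_F_bot i j : i < j -> A i j * F i = F i * F j.
Proof.
move=> ij; rewrite (A_gen ij) /F -!class_cat; apply: class_eq.
exact: rel_af_ff.
Qed.

Lemma F_A_top i j : i < j -> F j * A i j = F i * F j.
Proof.
move=> ij; rewrite -[RHS]A_F_bot // (A_gen ij) /F -!class_cat.
by apply: class_eq; exact: rel_fa_af'.
Qed.

Lemma A_comm i j k l : i != k -> i != l -> j != k -> j != l ->
  A i j * A k l = A k l * A i j.
Proof.
move=> ik il jk jl; have [ij|ji] := ltnP i j; last first.
  by rewrite (A_junk ji) mulg1 mul1g.
have [kl|lk] := ltnP k l; last by rewrite (A_junk lk) mulg1 mul1g.
by rewrite (A_gen ij) (A_gen kl) -!class_cat; apply: class_eq; exact: rel_aaC.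
Qed.

(** The case [i = j] serves the points fixed by a map: there [A i i = 1] and the identity reduces to
    [F_A_bot]. *)
Lemma A_A_chain i j k : i <= j -> j < k -> A j k * A i j = F j * A i k.
Proof.
rewrite leq_eqVlt => /predU1P[/val_inj <- jk | ij jk].
  by rewrite (@A_junk i i) // mulg1 F_A_bot.
have ik := ltn_trans ij jk.
rewrite (A_gen ij) (A_gen jk) (A_gen ik) /F -!class_cat; apply: class_eq.
exact: rel_aa.
Qed.

(** * Letters and partial products of a normal form *)

Definition letter x o : M n := if o is Some y then A y x else F x.

Lemma F_letter_comm k x o : k != x -> o != Some k ->
  F k * letter x o = letter x o * F k.
Proof.
case: o => [y|] kx /= yk; last exact: F_comm.
by apply: F_A_comm => //; apply: contra yk => /eqP->.
Qed.

Lemma A_letter_comm i j x o : i != x -> j != x -> o != Some i -> o != Some j ->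
  A i j * letter x o = letter x o * A i j.
Proof.
case: o => [y|] ix jx /= yi yj; last by rewrite F_A_comm // eq_sym.
by apply: A_comm => //; rewrite eq_sym; [move: yi | move: yj]; apply: contra => /eqP->.
Qed.

(** The bound [m] is a number rather than an ordinal so that it can reach [n]; the factor [1] is a
    default for positions outside ['I_n]. *)
Fixpoint prefix a (m : nat) : M n :=
  if m is m'.+1 then
    prefix a m' * (if insub m' is Some x then letter x (a x) else 1)
  else 1.

Lemma prefixS a x : prefix a x.+1 = prefix a x * letter x (a x).
Proof. by rewrite /= valK. Qed.

(** Hands the step an ordinal, as [prefixS] requires, and starts at any [m0], so that a product can
    be followed from the position where it has just changed. *)
Lemma prefix_ind (P : nat -> Prop) (m0 : nat) :
  P m0 -> (forall x, m0 <= x -> P x -> P x.+1) ->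
  forall m : nat, m0 <= m -> m <= n -> P m.
Proof.
move=> P0 PS m; elim: m => [|m IHm]; first by rewrite leqn0 => /eqP <-.
rewrite leq_eqVlt => /predU1P[<-//|m0m mn].
by apply: (PS (Ordinal mn)) => //=; apply: IHm => //; exact: ltnW.
Qed.

Lemma prefix_comm g a (m : nat) : m <= n ->
  (forall x, x < m -> g * letter x (a x) = letter x (a x) * g) ->
  g * prefix a m = prefix a m * g.
Proof.
move: m (leq0n m); apply: prefix_ind => //.
  by rewrite /= mulg1 mul1g.
move=> x _ IHx gP; rewrite prefixS mulgA IHx; last first.
  by move=> z zx; apply: gP; exact: ltnW.
by rewrite -!mulgA gP.
Qed.

Lemma eq_prefix a b (m : nat) : m <= n ->
  (forall x, x < m -> a x = b x) -> prefix a m = prefix b m.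
Proof.
move: m (leq0n m); apply: prefix_ind => // x _ IHx ab.
by rewrite !prefixS ab // IHx // => z zx; apply: ab; exact: ltnW.
Qed.

(** From [m0] on, both sides are multiplied on the right by the same letters. *)
Lemma prefix_extend g h a b (m0 m : nat) :
  g * prefix a m0 = h * prefix b m0 -> m0 <= m -> m <= n ->
  (forall x, m0 <= x -> a x = b x) -> g * prefix a m = h * prefix b m.
Proof.
move=> gh m0m mn ab; move: m m0m mn; apply: prefix_ind => // x m0x IHx.
by rewrite !prefixS !mulgA IHx ab.
Qed.

(** [F y] moves left past the letters of the points beyond [y], none of which is sent to [y]. The
    letter of [y] then absorbs it: it is [F y] or, since [y] is not fixed, some [A z y] with
    [z < y]. *)
Lemma prefix_absorb a y (m : nat) : m <= n -> y < m ->
  (forall x z, a x = Some z -> z <= x) ->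
  (forall x, x < m -> a x != Some y) -> prefix a m * F y = prefix a m.
Proof.
move=> mn ym deca; move: m (leq0n m) mn ym; apply: prefix_ind => // x _ IHx.
rewrite ltnS leq_eqVlt => /predU1P[/val_inj -> | yx] ay.
  have := ay x; rewrite ltnSn => /(_ isT); rewrite prefixS -mulgA.
  case ax: (a x) => [z|] /= zx; last by rewrite F_idem.
  rewrite A_F_top // ltn_neqAle deca // andbT.
  by apply: contra zx => /eqP/val_inj->.
rewrite prefixS -mulgA -F_letter_comm ?ay //; last by rewrite neq_ltn yx.
by rewrite mulgA IHx // => z zx; apply: ay; exact: ltnW.
Qed.

(** * Left multiplication of a normal form by a generator *)

Lemma F_prefix a b i : a \in ID_pred -> b i = None ->
  (forall x, x != i -> b x = a x) -> F i * prefix a n = prefix b n.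
Proof.
move=> /ID_predP[inja deca] bi ba; rewrite -[RHS]mul1g.
have Fi : F i * prefix a i = prefix a i * F i.
  apply: prefix_comm => [|x xi]; first exact: ltnW.
  apply: F_letter_comm; first by rewrite neq_ltn xi orbT.
  by apply: contraL xi => /eqP/deca; rewrite -leqNgt.
apply: (prefix_extend (m0 := i.+1)) => // [|x ix]; last first.
  by rewrite ba // neq_ltn ix orbT.
rewrite mul1g !prefixS bi /= -(eq_prefix (a := a)) ?(ltnW (ltn_ord i)) //; last first.
  by move=> x xi; rewrite ba // neq_ltn xi.
rewrite mulgA Fi -mulgA; case ai: (a i) => [y|] /=; last by rewrite F_idem.
have := deca _ _ ai; rewrite leq_eqVlt => /predU1P[/val_inj -> | yi].
  by rewrite A_junk // mulg1.
(* [F i * A y i = F y * F i], and [F y] is absorbed because [i] is the only preimage of [y]. *)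
rewrite F_A_top // mulgA (prefix_absorb (y := y)) // ?(ltnW (ltn_ord i)) //.
move=> x xi; apply: contraTneq xi => ax.
by rewrite (inja _ _ _ ax ai) ltnn.
Qed.

(** Here [b] is a_{i,j} followed by [a]. [A i j] commutes with the letters below [i]; at [i] it
    leaves [F i] behind, and what remains of it acts at [j]. *)
Lemma A_prefix a b i j : a \in ID_pred -> i < j -> b i = None -> b j = a i ->
  (forall x, x != i -> x != j -> b x = a x) -> A i j * prefix a n = prefix b n.
Proof.
move=> IDa ij bi bj ba; have /ID_predP[inja deca] := IDa.
have ltn_neq x y : x < y -> (x != y) * (y != x).
  by move=> xy; rewrite !neq_ltn xy orbT.
have Ai : A i j * prefix a i = prefix a i * A i j.
  apply: prefix_comm => [|x xi]; first exact: ltnW.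
  have aN k : x < k -> a x != Some k.
    by apply: contraL => /eqP/deca; rewrite -leqNgt.
  have xj := ltn_trans xi ij.
  by apply: A_letter_comm; rewrite ?aN // ?(ltn_neq _ _ xi) ?(ltn_neq _ _ xj).
have abi : prefix a i = prefix b i.
  apply: eq_prefix => [|x xi]; first exact: ltnW.
  by rewrite ba // ?(ltn_neq _ _ xi) ?(ltn_neq _ _ (ltn_trans xi ij)).
case ai: (a i) => [h|]; last first.
  (* Now [b j = a i = None], so [b] also arises from [a] by deleting [j]; it remains to compare
     [A i j] with [F j], which [A_F_bot] does at the letter [F i]. *)
  rewrite -(F_prefix (a := a) (b := b) (i := j)) ?bj ?ai //; last first.
    by move=> x xj; have [->|xi] := eqVneq x i; [rewrite bi ai | rewrite ba].
  apply: (prefix_extend (m0 := i.+1)) => //.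
  rewrite !prefixS ai /= mulgA Ai -mulgA A_F_bot // F_comm !mulgA; congr (_ * _).
  apply/esym/prefix_comm => [|x xi]; first exact: ltnW.
  have xj := ltn_trans xi ij.
  apply: F_letter_comm; first by rewrite (ltn_neq _ _ xj).
  by apply: contraL xj => /eqP/deca; rewrite -leqNgt.
have hi := deca _ _ ai.
(* At [i] the chain relation gives [A i j * A h i = F i * A h j]; from there on it is [A h j] that
   travels to [j]. *)
have Aj m : i < m -> m <= n -> m <= j -> A i j * prefix a m = prefix b m * A h j.
  move: m; apply: prefix_ind => [_ | x ix IHx xj].
    by rewrite !prefixS ai bi mulgA Ai -!mulgA abi /= A_A_chain.
  rewrite !prefixS mulgA IHx 1?ltnW // -!mulgA.
  rewrite ba ?(ltn_neq _ _ ix) ?(ltn_neq _ _ xj) // A_letter_comm //.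
  - by rewrite (ltn_neq _ _ (leq_ltn_trans hi ix)).
  - by rewrite (ltn_neq _ _ xj).
  - by apply: contraTneq ix => ax; rewrite (inja _ _ _ ax ai) ltnn.
  - by apply: contraL xj => /eqP/deca; rewrite -leqNgt.
rewrite -[RHS]mul1g; apply: (prefix_extend (m0 := j.+1)) => // [|x jx]; last first.
  by rewrite ba // ?(ltn_neq _ _ jx) ?(ltn_neq _ _ (ltn_trans ij jx)).
rewrite mul1g !prefixS mulgA Aj ?(ltnW (ltn_ord j)) // bj ai /= -mulgA.
have hj := leq_ltn_trans hi ij.
case aj: (a j) => [y|] /=; last by rewrite A_F_top.
have := deca _ _ aj; rewrite leq_eqVlt => /predU1P[/val_inj -> | yj].
  by rewrite (@A_junk j j) // mulg1.
have ayN x : a x = Some y -> x = j by move=> ax; exact: inja ax aj.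
have yh : y != h.
  by apply: contraTneq ij => yh; rewrite (ayN i) ?ltnn // ai yh.
(* Insert [F j] after [A h j], turn [F j * A y j] into [F y * F j], and move [F y] to the front, as
   [y] differs from [h] and [j]. *)
have -> : A h j * A y j = F y * A h j.
  rewrite -{1}(A_F_top hj) -mulgA F_A_top // mulgA -F_A_comm ?(ltn_neq _ _ yj) //.
  by rewrite -mulgA A_F_top.
rewrite mulgA (prefix_absorb (y := y)) // ?(ltnW (ltn_ord j)) //.
  move=> x z; have [->|xi] := eqVneq x i; first by rewrite bi.
  have [->|xj] := eqVneq x j; last by rewrite ba //; exact: deca.
  by rewrite bj => /deca zi; exact: leq_trans zi (ltnW ij).
move=> x xj; have [->|xi] := eqVneq x i; first by rewrite bi.
rewrite ba ?(ltn_neq _ _ xj) //.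
by apply: contraTneq xj => /ayN->; rewrite ltnn.
Qed.

(** * Evaluation of words in [ID n] *)

Definition gen_map (s : ID_generator n) : partial_map n :=
  match s with
  | inl i => [ffun x => if x == i then None else Some x]
  | inr p => [ffun x => if x == (val p).1 then None
                        else if x == (val p).2 then Some (val p).1 else Some x]
  end.

Lemma gen_map_ID s : gen_map s \in ID_pred.
Proof.
apply/ID_predP; case: s => [i|[[i j] /= ij]]; split=> [x y z|x y]; rewrite !ffunE /=.
- by have [//|_] := eqVneq x i; have [//|_] := eqVneq y i; move=> [->] [->].
- by case: eqP => // _ [->].
- have [//|xi] := eqVneq x i; have [//|yi] := eqVneq y i.
  have [->|_] := eqVneq x j; have [->|_] := eqVneq y j => //.
  + by move=> [iz] [yz]; rewrite yz iz eqxx in yi.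
  + by move=> [xz] [iz]; rewrite xz iz eqxx in xi.
  + by move=> [->] [->].
- case: eqP => // _; case: eqP => [-> [<-]|_ [->]] //; exact: ltnW.
Qed.

Definition gen_ID s : ID n := MkID (gen_map_ID s).

Definition eval u : ID n := foldr (fun s c => gen_ID s * c) 1 u.

Lemma ID_ext (c d : ID n) : (forall x, ID_map c x = ID_map d x) -> c = d.
Proof. by move=> cd; apply: val_inj; apply/ffunP. Qed.

Lemma eval_cat u v : eval (u ++ v) = eval u * eval v.
Proof. by elim: u => [|s u IHu] /=; rewrite ?mul1g // IHu mulgA. Qed.

Lemma eval_mapE u x :
  ID_map (eval u) x = foldl (fun o s => obind (gen_map s) o) (Some x) u.
Proof.
elim: u x => [|s u IHu] x; first by rewrite ID_oneE.
by rewrite [eval _]/= ID_mulE /=; case: (gen_map s x) => [y|] //=; elim: u {IHu}.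
Qed.

Lemma eval_relation u v : ID_relation u v -> eval u = eval v.
Proof.
have ltn_neq i j : i < j -> i <> j by move=> ij eij; rewrite eij ltnn in ij.
case=> [i|i j /eqP ij|i j k ij /eqP ki /eqP kj|i j ij|i j ij|i j ij|i j ij
       |i j k l ij kl /eqP ik /eqP il /eqP jk /eqP jl|i j k ij jk ik];
apply: ID_ext => x; rewrite !eval_mapE /=;
(* The inequalities between indices become disequalities; each relation is then a case analysis on
   equality tests at the point [x]. *)
repeat match goal with ij : is_true (_ < _) |- _ => move/ltn_neq: ij => ij end;
by repeat (rewrite ?ffunE /=; case: eqP => //= ?); congruence.
Qed.

Lemma eval_congruence u v : congruence_of (@ID_relation n) u v -> eval u = eval v.
Proof.
elim=> {u v} [u v||u v _|u v w _ uv _|u u' v v' _ uu' _ vv'] //.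
- exact: eval_relation.
- by rewrite uv.
- by rewrite !eval_cat uu' vv'.
Qed.

Definition eval_class g : ID n := eval (repr g).

Lemma eval_classE u : eval_class (class u) = eval u.
Proof. by apply: eval_congruence; apply/presented_piP; rewrite reprK. Qed.

Lemma eval_class_morphism : monoid_morphism eval_class.
Proof.
split; first exact: (eval_classE [::]).
elim/quotW=> u; elim/quotW=> v.
by rewrite -/(class u) -/(class v) -class_cat !eval_classE eval_cat.
Qed.

(** * Normal forms as the inverse of evaluation *)

Definition normal_form (c : ID n) : M n := prefix (ID_map c) n.

Lemma normal_form1 : normal_form 1 = 1.
Proof.
suff prefix1 (m : nat) : m <= n -> prefix (ID_map 1) m = 1 by exact: prefix1.
move: m (leq0n m); apply: prefix_ind => // x _ IHx.
by rewrite prefixS IHx mul1g ID_oneE /= A_junk.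
Qed.

Lemma normal_form_gen s c : class [:: s] * normal_form c = normal_form (gen_ID s * c).
Proof.
have IDc := valP c.
case: s => [i|[[i j] /= ij]].
  apply: (F_prefix IDc); first by rewrite ID_mulE ffunE eqxx.
  by move=> x xi; rewrite ID_mulE ffunE (negPf xi).
have ji : j != i by rewrite neq_ltn ij orbT.
rewrite -/(gen_a ij) -A_gen; apply: (A_prefix IDc) => //.
- by rewrite ID_mulE ffunE eqxx.
- by rewrite ID_mulE ffunE (negPf ji) eqxx.
- by move=> x xi xj; rewrite ID_mulE ffunE (negPf xi) (negPf xj).
Qed.

(** Induction on a word: [normal_form_gen] merges its first generator into the normal form of the
    rest. *)
Lemma eval_classK : cancel eval_class normal_form.
Proof.
elim/quotW=> u; rewrite -/(class u) eval_classE.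
elim: u => [|s u IHu] /=; first exact: normal_form1.
by rewrite -normal_form_gen IHu -class_cat.
Qed.

(** The order of the tests matters for [o = Some x]: the first one catches [z = x], so the letter
    [1] leaves no hole. *)
Lemma eval_letter x o z : (forall y, o = Some y -> y <= x) ->
  ID_map (eval_class (letter x o)) z =
  if z == x then o else if Some z == o then None else Some z.
Proof.
case: o => [y|] /= le_yx; last by rewrite eval_classE eval_mapE /= ffunE.
have := le_yx y erefl; rewrite leq_eqVlt => /predU1P[/val_inj->|yx].
  rewrite A_junk // eval_class_morphism.1 ID_oneE.
  by case: eqVneq => [->|] // /negPf zx; case: eqP => // -[] /eqP; rewrite zx.
rewrite (A_gen yx) eval_classE eval_mapE /= ffunE /= -[Some z == _]/(z == y).
by case: eqVneq => [->|//]; rewrite -val_eqE /= ltn_eqF.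
Qed.

(** The letter of [y] can only move [y] and delete [c y]. An earlier image differs from [c y] by
    injectivity, and a point beyond [y] differs from it because [c] is decreasing. *)
Lemma eval_prefix (c : ID n) (m : nat) x : m <= n ->
  ID_map (eval_class (prefix c m)) x = if x < m then ID_map c x else Some x.
Proof.
have /ID_predP[injc decc] : ID_map c \in ID_pred := valP c.
move: m (leq0n m); apply: prefix_ind => [|y _ IHy].
  by rewrite eval_class_morphism.1 ID_oneE.
have lety z := eval_letter z (decc y).
rewrite prefixS eval_class_morphism.2 ID_mulE IHy ltnS.
have [xy|yx|/val_inj->] /= := ltngtP x y; last by rewrite lety eqxx.
  case cx: (ID_map c x) => [z|] //=; rewrite lety.
  rewrite ifN ?ifN //; first by apply: contraTneq xy => /esym cy; rewrite (injc _ _ _ cx cy) ltnn.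
  by rewrite neq_ltn (leq_ltn_trans (decc _ _ cx) xy).
rewrite lety ifN ?ifN //; last by rewrite neq_ltn yx orbT.
by apply: contraTneq yx => /esym /decc; rewrite -leqNgt.
Qed.

Lemma normal_formK : cancel normal_form eval_class.
Proof. by move=> c; apply: ID_ext => x; rewrite eval_prefix // ltn_ord. Qed.

End NormalForm.

Theorem mainTheorem2 (n : nat) (n_ge1 : 1 <= n) : monoid_isomorphic (M n) (ID n).
Proof.
exists eval_class; first exact: eval_class_morphism.
by exists normal_form; [exact: eval_classK | exact: normal_formK].
Qed.
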